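(* For the generic $h \in \mathcal{H}(\{0,1\}^{\mathbb{N}})$, the induced map $\widetilde{h} : \mathcal{M}(\{0,1\}^{\mathbb{N}}) \to \mathcal{M}(\{0,1\}^{\mathbb{N}})$ does not have the weak shadowing property. That is, the set of all $h \in \mathcal{H}(\{0,1\}^{\mathbb{N}})$ for which $\widetilde{h}$ has the weak shadowing property is of the first category in $\mathcal{H}(\{0,1\}^{\mathbb{N}})$.
   Context: The Cantor space $\{0,1\}^{\mathbb{N}}$ ($\mathbb{N}=\{1,2,\dots\}$) carries the metric $d(\sigma,\sigma)=0$ and $d(\sigma,\tau)=1/n$, where $n$ is the least positive integer with $\sigma(n)\ne\tau(n)$. $\mathcal{H}(\{0,1\}^{\mathbb{N}})$ is the space of all homeomorphisms of $\{0,1\}^{\mathbb{N}}$ onto itself with the metric $\tilde d(f,g)=\max_x d(f(x),g(x))$; it is a Baire space. ''The generic element of a Baire space $Z$ has property $P$'' means that the set of elements of $Z$ failing $P$ is of the first category (meager) in $Z$. For a compact metric space $(M,d)$, $\mathcal{M}(M)$ is the space of Borel probability measures on $M$ with the Prohorov metric $d_P(\mu,\nu)=\inf\{\delta>0:\mu(X)\le\nu(X^\delta)+\delta \text{ and } \nu(X)\le\mu(X^\delta)+\delta \text{ for all Borel } X\subset M\}$, where $X^\delta=\{x\in M: d(x,X)<\delta\}$; it is a compact metric space. For a continuous map $f:M\to M$, the induced map $\widetilde f:\mathcal{M}(M)\to\mathcal{M}(M)$ is $(\widetilde f(\mu))(X)=\mu(f^{-1}(X))$ for Borel $X$; if $f$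 is a homeomorphism, so is $\widetilde f$. Let $g$ be a homeomorphism of a compact metric space $(K,\rho)$. A sequence $(x_n)_{n\in\mathbb{Z}}$ in $K$ is a $\delta$-pseudotrajectory of $g$ ($\delta>0$) if $\rho(g(x_n),x_{n+1})\le\delta$ for all $n\in\mathbb{Z}$. The map $g$ has the weak shadowing property if for every $\varepsilon>0$ there exists $\delta>0$ such that for every $\delta$-pseudotrajectory $(x_n)_{n\in\mathbb{Z}}$ of $g$ there exists $x\in K$ with $\{x_n:n\in\mathbb{Z}\}\subset\{g^n(x):n\in\mathbb{Z}\}^\varepsilon$, where $A^\varepsilon=\{y\in K:\rho(y,A)<\varepsilon\}$. *)

(* Defs.v *)
From HB Require Import structures.
From mathcomp Require Import all_boot all_order all_algebra generic_quotient.
From mathcomp Require Import all_classical all_reals all_analysis.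

Set Implicit Arguments.
Unset Strict Implicit.
Unset Printing Implicit Defensive.

Import Order.TTheory GRing.Theory Num.Theory.
Import numFieldNormedType.Exports.

Local Open Scope classical_set_scope.
Local Open Scope ring_scope.
Local Open Scope quotient_scope.

Definition nowhere_dense {T : topologicalType} (A : set T) : Prop :=
  interior (closure A) = set0.

Definition first_category {T : topologicalType} (A : set T) : Prop :=
  exists F : (set T)^nat,
    (forall n, nowhere_dense (F n)) /\ A = \bigcup_n F n.

Record homeo (T : topologicalType) := Homeo {
  homeo_fun :> T -> T;
  homeo_inv : T -> T;
  homeo_cts : continuous homeo_fun;
  homeo_inv_cts : continuous homeo_inv;
  homeo_funK : cancel homeo_fun homeo_inv;
  homeo_invK : cancel homeo_inv homeo_fun }.

Lemma homeo_ext (T : topologicalType) (f g : homeo T) : f =1 g -> f = g.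
Proof.
case: f g => [f fi cf cfi fK fiK] [g gi cg cgi gK giK] /= fg.
have efg : f = g by apply/funext.
subst g.
have egi : fi = gi by apply/funext => x; rewrite -{1}(giK x) fK.
subst gi.
by congr Homeo; exact: Prop_irrelevance.
Qed.

HB.instance Definition _ (T : topologicalType) := gen_eqMixin (homeo T).
HB.instance Definition _ (T : topologicalType) := gen_choiceMixin (homeo T).

Definition homeo_iter (T : topologicalType) (f : homeo T) (n : int) (x : T) :
    T :=
  match n with
  | Posz k => iter k f x
  | Negz k => iter k.+1 (homeo_inv f) x
  end.

Section metric_notions.
Context {R : realType} {K : metricType R}.

(* An infimum in \bar R, hence +oo when A is empty. *)
Definition set_dist (x : K) (A : set K) : \bar R :=
  ereal_inf [set (mdist x y)%:E | y in A].

Definition set_nbhd (A : set K) (e : R) : set K :=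
  [set x | (set_dist x A < e%:E)%E].

Lemma set_nbhdP (A : set K) (e : R) (x : K) :
  set_nbhd A e x <-> exists2 y, A y & mdist x y < e.
Proof.
split=> [/ereal_inf_lt[_ [y Ay <-]]|[y Ay xye]].
  by rewrite lte_fin => xye; exists y.
apply/ereal_inf_ltP; exists (mdist x y)%:E; last by rewrite lte_fin.
by exists y.
Qed.

Definition pseudotrajectory (g : K -> K) (delta : R) (x : int -> K) : Prop :=
  forall n : int, mdist (g (x n)) (x (n + 1)) <= delta.

Definition weak_shadowing (g : homeo K) : Prop :=
  forall eps : R, 0 < eps ->
  exists2 delta : R, 0 < delta &
    forall x : int -> K, pseudotrajectory g delta x ->
    exists y : K, range x `<=` set_nbhd (range (homeo_iter g ^~ y)) eps.

End metric_notions.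

(* Types carrying a sigma-algebra are pointed in the library. *)
#[short(type="pmetricType")]
HB.structure Definition PointedMetric (R : numDomainType) :=
  { M of Pointed M & Metric R M }.

Definition borel {R : realType} (M : pmetricType R) : Type :=
  g_sigma_algebraType (@open M).

HB.instance Definition _ {R : realType} (M : pmetricType R) :=
  Measurable.on (borel M).

Section prohorov.
Context {R : realType} (M : pmetricType R).
Implicit Types mu nu : probability (borel M) R.

Definition prob_eq mu nu : bool :=
  `[< forall X : set (borel M), measurable X -> mu X = nu X >].

Let prob_eq_refl : reflexive prob_eq.
Proof. by move=> mu; apply/asboolP. Qed.

Let prob_eq_sym : symmetric prob_eq.
Proof.
move=> mu nu; apply/idP/idP => /asboolP e;
  by apply/asboolP => X mX; rewrite e.
Qed.

Let prob_eq_trans : transitive prob_eq.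
Proof.
move=> mu nu rho /asboolP e /asboolP e'; apply/asboolP => X mX.
by rewrite e// e'.
Qed.

Canonical prob_equiv := EquivRel prob_eq prob_eq_refl prob_eq_sym prob_eq_trans.

(* A probability of the library is a function on all sets, constrained on the *)
(* measurable ones only; its values on the other sets are quotiented out.     *)
Definition pmeasure : Type := {eq_quot prob_equiv}.

HB.instance Definition _ := Choice.on pmeasure.
HB.instance Definition _ := EqQuotient.on pmeasure.

Lemma pmeasure_piE mu (X : set (borel M)) : measurable X ->
  repr (\pi_pmeasure mu) X = mu X.
Proof.
move=> mX.
suff /(eqquotP pmeasure)/asboolP : repr (\pi_pmeasure mu) = mu %[mod pmeasure].
  exact.
by rewrite reprK.
Qed.

Definition prohorov_bound mu nu : set R :=
  [set delta | 0 < delta /\ forall X : set (borel M), measurable X ->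
    (mu X <= nu (set_nbhd X delta) + delta%:E)%E /\
    (nu X <= mu (set_nbhd X delta) + delta%:E)%E].

Definition prohorov (mu nu : pmeasure) : R :=
  inf (prohorov_bound (repr mu) (repr nu)).

Lemma set_nbhd_open (A : set M) e : open (set_nbhd A e).
Proof.
rewrite openE => x /set_nbhdP[y Ay xye].
apply/nbhs_ballP; exists (e - mdist x y); first by rewrite /= subr_gt0.
move=> z; rewrite ballEmdist/= ltrBrDr => xz; apply/set_nbhdP; exists y => //.
by rewrite (le_lt_trans (metric_triangle _ x _))// metric_sym.
Qed.

Lemma set_nbhd_measurable (A : set (borel M)) e :
  measurable (set_nbhd A e : set (borel M)).
Proof. by apply: sub_sigma_algebra; exact: set_nbhd_open. Qed.

Lemma subset_set_nbhd (A : set M) e : 0 < e -> A `<=` set_nbhd A e.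
Proof. by move=> e0 x Ax; apply/set_nbhdP; exists x; rewrite ?mdistxx. Qed.

Lemma le_set_nbhd (A : set M) e e' : e <= e' -> set_nbhd A e `<=` set_nbhd A e'.
Proof.
move=> ee' x /set_nbhdP[y Ay xy]; apply/set_nbhdP; exists y => //.
exact: lt_le_trans ee'.
Qed.

Let le_prob mu (A B : set (borel M)) :
  measurable A -> measurable B -> A `<=` B -> (mu A <= mu B)%E.
Proof. by move=> mA mB AB; apply: le_measure; rewrite ?inE. Qed.

Lemma prohorov_boundW mu nu d e :
  prohorov_bound mu nu d -> d <= e -> prohorov_bound mu nu e.
Proof.
move=> [d0 H] de; split; first exact: lt_le_trans de.
move=> X mX; have [H1 H2] := H _ mX.
split; [apply: le_trans H1 _|apply: le_trans H2 _];
  (apply: leeD; last by rewrite lee_fin);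
  by apply: le_prob; [exact: set_nbhd_measurable..|exact: le_set_nbhd].
Qed.

Lemma prohorov_bound1 mu nu : prohorov_bound mu nu 1.
Proof.
split=> // X mX.
by split; (apply: le_trans (probability_le1 _ mX) _; rewrite leeDr).
Qed.

Lemma has_inf_prohorov_bound mu nu : has_inf (prohorov_bound mu nu).
Proof.
split; first by exists 1; exact: prohorov_bound1.
by exists 0 => d [/ltW].
Qed.

Lemma prohorov_ltP (mu nu : pmeasure) e :
  prohorov mu nu < e -> prohorov_bound (repr mu) (repr nu) e.
Proof.
move=> /inf_lt[|d Hd /ltW]; first by have [] := has_inf_prohorov_bound (repr mu) (repr nu).
exact: prohorov_boundW.
Qed.

Lemma prohorov_le (mu nu : pmeasure) e :
  prohorov_bound (repr mu) (repr nu) e -> prohorov mu nu <= e.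
Proof. by apply: ge_inf; case: (has_inf_prohorov_bound (repr mu) (repr nu)). Qed.

Lemma prohorov_ge0 (mu nu : pmeasure) : 0 <= prohorov mu nu.
Proof.
apply: lb_le_inf; first by case: (has_inf_prohorov_bound (repr mu) (repr nu)).
by move=> d [/ltW].
Qed.

Let prohorovxx (mu : pmeasure) : prohorov mu mu = 0.
Proof.
apply/eqP; rewrite eq_le prohorov_ge0 andbT; apply/ler_addgt0Pl => e e0.
rewrite addr0; apply: prohorov_le; split => // X mX.
suff H : (repr mu X <= repr mu (set_nbhd X e) + e%:E)%E by [].
rewrite -[leLHS]adde0; apply: leeD; last by rewrite lee_fin ltW.
by apply: le_prob => //; [exact: set_nbhd_measurable|exact: subset_set_nbhd].
Qed.

Let prohorov_sym (mu nu : pmeasure) : prohorov mu nu = prohorov nu mu.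
Proof.
congr inf; apply/seteqP.
by split=> d [d0 H]; split=> // X mX; have [] := H _ mX.
Qed.

Let prohorov_triangle (nu mu rho : pmeasure) :
  prohorov mu rho <= prohorov mu nu + prohorov nu rho.
Proof.
apply/ler_addgt0Pr => e e0.
have e20 : 0 < e / 2 by rewrite divr_gt0.
have /prohorov_ltP[d10 H1] : prohorov mu nu < prohorov mu nu + e / 2 by rewrite ltrDl.
have /prohorov_ltP[d20 H2] : prohorov nu rho < prohorov nu rho + e / 2 by rewrite ltrDl.
rewrite [e in leRHS]splitr addrACA.
move: (prohorov mu nu + e / 2) (prohorov nu rho + e / 2) d10 d20 H1 H2.
move=> d1 d2 d10 d20 H1 H2.
have nbhdD (X : set M) a b : set_nbhd (set_nbhd X a) b `<=` set_nbhd X (a + b).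
  move=> x /set_nbhdP[y /set_nbhdP[z Xz yz] xy]; apply/set_nbhdP; exists z => //.
  by rewrite (le_lt_trans (metric_triangle _ y _))// addrC ltrD.
apply: prohorov_le; split; first by rewrite addr_gt0.
move=> X mX; split.
- have [H _] := H1 _ mX; apply: le_trans H _.
  rewrite [d1 + d2]addrC EFinD addeA [d2 + d1]addrC; apply: leeD => //.
  have [H _] := H2 _ (set_nbhd_measurable X d1); apply: le_trans H _.
  apply: leeD => //; apply: le_prob; [exact: set_nbhd_measurable..|exact: nbhdD].
- have [_ H] := H2 _ mX; apply: le_trans H _.
  rewrite EFinD addeA; apply: leeD => //.
  have [_ H] := H1 _ (set_nbhd_measurable X d2); apply: le_trans H _.
  apply: leeD => //; apply: le_prob; [exact: set_nbhd_measurable..|].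
  by rewrite addrC; exact: nbhdD.
Qed.

Let closed_measurable (X : set M) : closed X -> measurable (X : set (borel M)).
Proof.
move=> cX; rewrite -[X]setCK; apply: measurableC.
by apply: sub_sigma_algebra; exact/closed_openC.
Qed.

Let prohorov0_closed (mu nu : pmeasure) (X : set (borel M)) :
  prohorov mu nu = 0 -> closed (X : set M) -> (repr mu X <= repr nu X)%E.
Proof.
move=> mn0 cX; have mX := closed_measurable cX.
pose F n : set (borel M) := set_nbhd X n.+1%:R^-1.
have mF n : measurable (F n) by exact: set_nbhd_measurable.
have FX : \bigcap_n F n = X.
  apply/seteqP; split=> [x Fx|x Xx n _]; last exact: subset_set_nbhd.
  rewrite (closure_id X).1// => B /nbhs_ballP[e /= e0 eB].
  have [n _ ne] : exists2 n, True & n.+1%:R^-1 < e.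
    have [n _ /(_ n (leqnn n))/= ?] := near_infty_natSinv_lt (PosNum e0).
    by exists n.
  have /set_nbhdP[y Xy xy] := Fx n I.
  exists y; split => //; apply: eB; rewrite ballEmdist/=.
  exact: lt_trans ne.
have cvF : repr nu \o F @ \oo --> repr nu X.
  rewrite -FX; apply: nonincreasing_cvg_mu => //.
  - by rewrite (le_lt_trans (probability_le1 _ (mF 0%N)))// ltry.
  - by rewrite FX.
  - move=> m n mn; apply/subsetPset/le_set_nbhd.
    by rewrite lef_pV2 ?posrE// ler_nat.
have cvI : (n.+1%:R^-1 : R)%:E @[n --> \oo] --> 0%E.
  by apply: cvg_EFin; [exact: nearW|exact: cvg_harmonic].
have cvS : (repr nu (F n) + (n.+1%:R^-1 : R)%:E)%E @[n --> \oo] --> (repr nu X + 0)%E.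
  by apply: cvgeD => //; rewrite fin_num_adde_defl.
rewrite adde0 in cvS.
rewrite -(cvg_lim _ cvS)//; apply: lime_ge; first by apply/cvg_ex; eexists; exact: cvS.
apply: nearW => n.
have /prohorov_ltP[_ H] : prohorov mu nu < n.+1%:R^-1 by rewrite mn0 invr_gt0.
by have [] := H _ mX.
Qed.

Let prohorov_positivity (mu nu : pmeasure) : prohorov mu nu = 0 -> mu = nu.
Proof.
move=> mn0; rewrite -[mu]reprK -[nu]reprK; apply/(eqquotP pmeasure)/asboolP => X mX.
have openE (U : set (borel M)) : open (U : set M) -> repr mu U = repr nu U.
  move=> oU; have cU := open_closedC oU.
  have mCU := closed_measurable cU.
  rewrite -[U]setCK (probability_setC (repr mu) mCU).
  rewrite (probability_setC (repr nu) mCU).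
  congr (_ - _)%E; apply/eqP; rewrite eq_le; apply/andP; split.
    exact: prohorov0_closed.
  by apply: prohorov0_closed => //; rewrite prohorov_sym.
have openI' : setI_closed (@open M) by move=> A B; exact: openI.
have cover : \bigcup_(_ in [set: nat]) [set: borel M] = setT.
  by rewrite bigcup_const//; exists 0%N.
apply: (@measure_unique _ R (borel M) (@open M) (fun=> setT) erefl openI'
  (fun=> openT) cover (repr mu) (repr nu) openE) => //.
move=> _; exact: le_lt_trans (probability_le1 (repr mu) measurableT) (ltry _).
Qed.

HB.instance Definition _ := isMetric.Build R pmeasure
  prohorovxx prohorov_positivity prohorov_sym prohorov_triangle.

End prohorov.

Section induced.
Context {R : realType} {M : pmetricType R}.

Definition borel_fun (f : M -> M) (cf : continuous f) : borel M -> borel M := f.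

Lemma borel_fun_measurable (f : M -> M) (cf : continuous f) :
  measurable_fun [set: borel M] (borel_fun cf).
Proof.
apply: (@measurability _ _ (borel M) (borel M) setT _ (@open M)) => //.
move=> _ [B oB <-]; rewrite setTI.
by apply: sub_sigma_algebra; apply: open_comp => // x _; exact: cf.
Qed.

HB.instance Definition _ (f : M -> M) (cf : continuous f) :=
  isMeasurableFun.Build _ _ _ _ (borel_fun cf) (borel_fun_measurable cf).

(* distribution mu f is the image measure X |-> mu (f @^-1` X); see           *)
(* induced_mapE for the resulting formula on representatives.                 *)
Definition induced_map (f : M -> M) (cf : continuous f) (mu : pmeasure M) :
    pmeasure M :=
  \pi_(pmeasure M)
    (distribution (repr mu) (borel_fun cf) : probability (borel M) R).

Lemma induced_mapE (f : M -> M) (cf : continuous f) mu (X : set (borel M)) :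
  measurable X -> repr (induced_map cf mu) X = repr mu (f @^-1` X).
Proof. exact: pmeasure_piE. Qed.

Lemma pmeasure_ext (mu nu : pmeasure M) :
  (forall X : set (borel M), measurable X -> repr mu X = repr nu X) -> mu = nu.
Proof.
by move=> e; rewrite -[mu]reprK -[nu]reprK; apply/(eqquotP (pmeasure M))/asboolP.
Qed.

Lemma measurable_preimage (f : M -> M) (cf : continuous f)
    (X : set (borel M)) :
  measurable X -> measurable (f @^-1` X : set (borel M)).
Proof.
by move=> mX; rewrite -[X in measurable X]setTI; exact: (borel_fun_measurable cf).
Qed.

Lemma induced_mapK (f g : M -> M) (cf : continuous f) (cg : continuous g) :
  cancel f g -> cancel (induced_map cf) (induced_map cg).
Proof.
move=> fK mu; apply: pmeasure_ext => X mX; rewrite !induced_mapE//; last first.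
  exact: measurable_preimage.
by rewrite -comp_preimage; congr (repr mu _); apply/seteqP; split=> x /=; rewrite fK.
Qed.

Lemma compact_unif_cts (f : M -> M) : compact [set: M] -> continuous f ->
  forall e : R, 0 < e ->
  exists2 d : R, 0 < d & forall x y, mdist x y < d -> mdist (f x) (f y) < e.
Proof.
move=> /compact_near_coveringP cM cf e e0.
have /cM : forall x : M, [set: M] x -> \forall x' \near x & d \near 0^'+,
    forall y, mdist x' y < d -> mdist (f x') (f y) < e.
  move=> x _; have e20 : 0 < e / 2 by rewrite divr_gt0.
  have /nbhs_ballP[r /= r0 rf] := cf x _ (nbhsx_ballx (f x) _ e20).
  have r20 : 0 < r / 2 by rewrite divr_gt0.
  exists (ball x (r / 2), [set d | d < r / 2]).
    by split => /=; [exact: nbhsx_ballx|exact: nbhs_right_lt].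
  move=> [x' d] /= [xx' dr] y x'y.
  have fx' : ball (f x) (e / 2) (f x').
    by apply: rf; apply: le_ball xx'; rewrite ler_pdivrMr// ler_peMr ?ler1n// ltW.
  have fy : ball (f x) (e / 2) (f y).
    apply: rf; rewrite [r]splitr; apply: ball_triangle xx' _.
    by rewrite ballEmdist/=; exact: lt_trans dr.
  by have := ball_splitr fx' fy; rewrite ballEmdist.
move=> [d /= d0 dP]; exists (d / 2); first by rewrite divr_gt0.
move=> x y xy; apply: (dP (d / 2) _ _ x) => //=; last by rewrite divr_gt0.
by rewrite /ball/= sub0r normrN gtr0_norm ?divr_gt0// ltr_pdivrMr// ltr_pMr// ltr1n.
Qed.

Lemma induced_continuous (f : M -> M) (cf : continuous f) :
  compact [set: M] -> continuous (induced_map cf).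
Proof.
move=> cM mu A /nbhs_ballP[e /= e0 eA].
have e20 : 0 < e / 2 by rewrite divr_gt0.
have [d d0 dP] := compact_unif_cts cM cf e20.
pose m := Num.min d (e / 2).
have m0 : 0 < m by rewrite lt_min d0.
apply/nbhs_ballP; exists m => //= nu; rewrite ballEmdist/=.
move=> /prohorov_ltP[_ H]; apply: eA; rewrite ballEmdist/=.
apply: (@le_lt_trans _ _ (e / 2)); last by rewrite ltr_pdivrMr// ltr_pMr// ltr1n.
apply: prohorov_le; split => // X mX.
have [H1 H2] := H _ (measurable_preimage cf mX).
have mN := set_nbhd_measurable X (e / 2).
have sub : set_nbhd (f @^-1` X) m `<=` f @^-1` (set_nbhd X (e / 2)).
  move=> x /set_nbhdP[y Xfy xy]; apply/set_nbhdP; exists (f y) => //.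
  by apply: dP; apply: lt_le_trans xy _; rewrite ge_min lexx.
have me : (m%:E <= (e / 2)%:E)%E by rewrite lee_fin ge_min lexx orbT.
rewrite !induced_mapE//; split.
- apply: le_trans H1 _; apply: leeD me; apply: le_measure => //; rewrite inE.
    exact: set_nbhd_measurable.
  exact: measurable_preimage.
- apply: le_trans H2 _; apply: leeD me; apply: le_measure => //; rewrite inE.
    exact: set_nbhd_measurable.
  exact: measurable_preimage.
Qed.

Definition induced_homeo (cM : compact [set: M]) (h : homeo M) :
    homeo (pmeasure M) :=
  Homeo (induced_continuous (cf := @homeo_cts _ h) cM)
        (induced_continuous (cf := @homeo_inv_cts _ h) cM)
        (induced_mapK (@homeo_cts _ h) (@homeo_inv_cts _ h) (@homeo_funK _ h))
        (induced_mapK (@homeo_inv_cts _ h) (@homeo_cts _ h) (@homeo_invK _ h)).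

End induced.

(* Coordinates are indexed from 0, so that d(s, t) = 1 / (n + 1) for the least *)
(* n : nat with s n <> t n. The parameter R is the type of the distances.      *)
Definition cantor (R : realType) : Type := nat -> bool.

HB.instance Definition _ (R : realType) := Choice.on (cantor R).
HB.instance Definition _ (R : realType) :=
  isPointed.Build (cantor R) (fun=> false).

Section cantor.
Variable R : realType.

Definition cantor_dist (s t : cantor R) : R :=
  if pselect (exists n, s n != t n) is left st then (ex_minn st).+1%:R^-1
  else 0.

Lemma cantor_dist_ge0 s t : 0 <= cantor_dist s t.
Proof. by rewrite /cantor_dist; case: pselect. Qed.

Lemma cantor_dist_le1 s t : cantor_dist s t <= 1.
Proof.
rewrite /cantor_dist; case: pselect => // ?.
by rewrite invf_le1 ?ler1n// ltr0n.
Qed.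

Lemma cantor_dist_geP s t n :
  reflect (exists2 k, (k <= n)%N & s k != t k) (n.+1%:R^-1 <= cantor_dist s t).
Proof.
rewrite /cantor_dist; case: pselect => [st|nst].
  case: ex_minnP => m stm min_m.
  rewrite lef_pV2 ?posrE// ler_nat ltnS; apply: (iffP idP) => [mn|[k kn /min_m]].
    by exists m.
  by move=> /leq_trans; apply.
rewrite leNgt invr_gt0 ltr0n/=; apply: (iffP idP) => // -[k _ stk].
by case: nst; exists k.
Qed.

Lemma cantor_distE s t : cantor_dist s t = 0 \/
  exists2 n, s n != t n & cantor_dist s t = n.+1%:R^-1.
Proof.
rewrite /cantor_dist; case: pselect => [st|nst]; last by left.
by right; case: ex_minnP => m stm _; exists m.
Qed.

Let cantor_distxx s : cantor_dist s s = 0.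
Proof. by have [//|[n]] := cantor_distE s s; rewrite eqxx. Qed.

Let cantor_dist_positivity s t : cantor_dist s t = 0 -> s = t.
Proof.
move=> st0; apply/funext => n; apply/eqP/negPn/negP => stn.
have : n.+1%:R^-1 <= cantor_dist s t by apply/cantor_dist_geP; exists n.
by rewrite st0 leNgt invr_gt0 ltr0n.
Qed.

Let cantor_dist_sym s t : cantor_dist s t = cantor_dist t s.
Proof.
suff H s' t' : cantor_dist s' t' <= cantor_dist t' s'.
  by apply/eqP; rewrite eq_le !H.
have [->|[n stn ->]] := cantor_distE s' t'; first exact: cantor_dist_ge0.
by apply/cantor_dist_geP; exists n => //; rewrite eq_sym.
Qed.

Let cantor_dist_triangle t s u :
  cantor_dist s u <= cantor_dist s t + cantor_dist t u.
Proof.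
have [->|[n sun ->]] := cantor_distE s u.
  by rewrite addr_ge0 ?cantor_dist_ge0.
have [stn|stn] := eqVneq (s n) (t n).
  rewrite -[leLHS]add0r lerD ?cantor_dist_ge0//.
  by apply/cantor_dist_geP; exists n; rewrite -?stn.
rewrite -[leLHS]addr0 lerD ?cantor_dist_ge0//.
by apply/cantor_dist_geP; exists n.
Qed.

HB.instance Definition _ := isMetric.Build R (cantor R)
  cantor_distxx cantor_dist_positivity cantor_dist_sym cantor_dist_triangle.

Lemma cantor_compact : compact [set: cantor R].
Proof.
have cid : continuous (fun x : cantor_space => x : cantor R).
  move=> x A /nbhs_ballP[e /= e0 eA].
  have [n _ ne] : exists2 n, True & n.+1%:R^-1 < e.
    have [n _ /(_ n (leqnn n))/= ?] := near_infty_natSinv_lt (PosNum e0).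
    by exists n.
  have : forall m, \forall y \near (x : cantor_space),
      forall k, (k < m)%N -> y k = x k.
    elim=> [|m IH]; first exact: filterE.
    have Hm : \forall y \near (x : cantor_space), y m = x m.
      exact: (@proj_continuous nat (fun=> bool) m x _ (discrete_set1 (x m))).
    near=> y => k; rewrite ltnS leq_eqVlt => /orP[/eqP ->|].
      by near: y.
    by move: k; near: y.
  move=> /(_ n.+1); apply: filterS => y yx; apply: eA.
  rewrite ballEmdist/=; apply: lt_trans ne.
  rewrite ltNge; apply/negP => /cantor_dist_geP[k kn].
  by rewrite yx ?eqxx.
rewrite (_ : [set: cantor R] = (fun x : cantor_space => x : cantor R) @` setT).
  apply: continuous_compact; last exact: cantor_space_compact.
  exact: continuous_subspaceT.
by apply/seteqP; split => // x _; exists x.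
Unshelve. all: by end_near. Qed.

End cantor.
Arguments cantor_compact : clear implicits.

Section cantor_homeo.
Variable R : realType.

Definition cantor_homeo : Type := homeo (cantor R).

HB.instance Definition _ := Choice.on cantor_homeo.

Implicit Types f g : cantor_homeo.

(* The supremum is attained: see cantor_homeo_dist_max. *)
Definition cantor_homeo_dist f g : R := sup (range (fun x => mdist (f x) (g x))).

Let dist_ubound f g : ubound (range (fun x => mdist (f x) (g x))) 1.
Proof. by move=> _ [x _ <-]; exact: cantor_dist_le1. Qed.

Lemma cantor_homeo_dist_ge f g x : mdist (f x) (g x) <= cantor_homeo_dist f g.
Proof. by apply: ub_le_sup; [exists 1; exact: dist_ubound|exists x]. Qed.

Lemma cantor_homeo_dist_le f g (e : R) :
  (forall x, mdist (f x) (g x) <= e) -> cantor_homeo_dist f g <= e.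
Proof.
move=> fge; apply: ge_sup; first by exists (mdist (f point) (g point)); exists point.
by move=> _ [x _ <-].
Qed.

Lemma cantor_homeo_dist_max f g :
  exists x, cantor_homeo_dist f g = mdist (f x) (g x).
Proof.
suff [x xmax] : exists x, forall y, mdist (f y) (g y) <= mdist (f x) (g x).
  exists x; apply/eqP; rewrite eq_le cantor_homeo_dist_ge andbT.
  exact: cantor_homeo_dist_le.
have [fg|/existsNP[x0 /eqP fg0]] := pselect (forall x, f x = g x).
  by exists point => y; rewrite !fg !mdistxx.
pose P n := `[< exists x, f x n != g x n >].
have exP : exists n, P n.
  have [fg|/existsNP[n /eqP fgn]] := pselect (forall n, f x0 n = g x0 n).
    by case/eqP: fg0; apply/funext.
  by exists n; apply/asboolP; exists x0.
have [n /asboolP[x fgx] nmin] := ex_minnP exP.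
exists x => y; change (cantor_dist (f y) (g y) <= cantor_dist (f x) (g x)).
have [->|[m fgm ->]] := cantor_distE (f y) (g y).
  exact: cantor_dist_ge0.
by apply/cantor_dist_geP; exists n => //; apply: nmin; apply/asboolP; exists y.
Qed.

Let cantor_homeo_distxx f : cantor_homeo_dist f f = 0.
Proof. by have [x ->] := cantor_homeo_dist_max f f; rewrite mdistxx. Qed.

Let cantor_homeo_dist_positivity f g : cantor_homeo_dist f g = 0 -> f = g.
Proof.
move=> fg0; apply: homeo_ext => x; apply: mdist_positivity.
by apply/eqP; rewrite eq_le mdist_ge0 -fg0 cantor_homeo_dist_ge.
Qed.

Let cantor_homeo_dist_sym f g : cantor_homeo_dist f g = cantor_homeo_dist g f.
Proof.
by congr sup; apply/seteqP; split=> _ [x _ <-]; exists x => //;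
  rewrite metric_sym.
Qed.

Let cantor_homeo_dist_triangle g f h :
  cantor_homeo_dist f h <= cantor_homeo_dist f g + cantor_homeo_dist g h.
Proof.
apply: cantor_homeo_dist_le => x; apply: le_trans (metric_triangle _ (g x) _) _.
by rewrite lerD ?cantor_homeo_dist_ge.
Qed.

HB.instance Definition _ := isMetric.Build R cantor_homeo
  cantor_homeo_distxx cantor_homeo_dist_positivity cantor_homeo_dist_sym
  cantor_homeo_dist_triangle.

End cantor_homeo.

(* Main.v *)
(* Call U clopen when membership in U is constant on d-balls for some d > 0.  *)
(* If h has a proper nonempty invariant clopen set U, then mu(U) is constant   *)
(* along the orbits of the induced map, whereas, for a in U and b outside U,   *)
(* letting t_n increase slowly from 0 to 1, the measures                       *)
(* (1 - t_n) delta_{h^n a} + t_n delta_{h^n b} form a pseudotrajectory on      *)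
(* which the mass of U drops from 1 to 0; so the induced map fails weak        *)
(* shadowing. The existence of such a U is an open condition on h. It is       *)
(* dense: if p is the least time at which some point x returns to its own      *)
(* N-cylinder under g, composing g with the involution that exchanges a small  *)
(* neighbourhood V of x with g^p V inside this cylinder makes                  *)
(* V u gV u ... u g^(p-1)V invariant, and by minimality of p this set meets    *)
(* the cylinder in V only.                                                     *)
From HB Require Import structures.
Require Import Defs.
From mathcomp Require Import all_boot all_order all_algebra generic_quotient.
From mathcomp Require Import all_classical all_reals all_analysis.
From mathcomp Require Import lra.

Set Implicit Arguments.
Unset Strict Implicit.
Unset Printing Implicit Defensive.

Import Order.TTheory GRing.Theory Num.Theory.
Import numFieldNormedType.Exports.

Local Open Scope classical_set_scope.
Local Open Scope ring_scope.
Local Open Scope quotient_scope.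

(** The set in question is itself nowhere dense. Arbitrarily near any [g] there is an [h] with a
    proper nonempty clopen invariant set ([invariant_set_dense]), every map close enough to [h]
    keeps that same set invariant, and such a set rules out weak shadowing
    ([invariant_not_weak_shadowing]). The perturbation rests on a pigeonhole return time
    ([minimal_return_time]) and on a tower of iterates closed up by a swap ([swap_homeo],
    [tower_invariant], [tower_meet]). *)

(** * Uniformly clopen sets *)

Section unif_clopen.
Context {R : realType} {K : metricType R}.
Implicit Types U V : set K.

(** The uniform [d] serves twice: small neighbourhoods of [U] stay in [U], and maps [d]-close to
    each other agree on which points they send into [U]. *)
Definition unif_clopen U : Prop :=
  exists2 d : R, 0 < d & forall x y, mdist x y < d -> U x -> U y.

Lemma unif_clopenC U : unif_clopen U -> unif_clopen (~` U).
Proof.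
move=> [d d0 Ud]; exists d => // x y xy nUx Uy; apply: nUx.
by apply: Ud Uy; rewrite metric_sym.
Qed.

Lemma unif_clopenI U V : unif_clopen U -> unif_clopen V -> unif_clopen (U `&` V).
Proof.
move=> [d d0 Ud] [e e0 Ve]; exists (Num.min d e); first by rewrite lt_min d0.
by move=> x y; rewrite lt_min => /andP[xyd xye] [/(Ud _ _ xyd) ? /(Ve _ _ xye)].
Qed.

Lemma unif_clopenU U V : unif_clopen U -> unif_clopen V -> unif_clopen (U `|` V).
Proof.
by move=> cU cV; rewrite -[_ `|` _]setCK setCU;
  apply/unif_clopenC/unif_clopenI; apply: unif_clopenC.
Qed.

Lemma unif_clopen_set0 : unif_clopen set0.
Proof. by exists 1. Qed.

Lemma unif_clopen_open U : unif_clopen U -> open U.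
Proof.
move=> [d d0 Ud]; rewrite openE => x Ux; apply/nbhs_ballP; exists d => // y.
by rewrite ballEmdist/= => /Ud; apply.
Qed.

Lemma unif_clopen_nbhd_sub U : unif_clopen U ->
  exists2 d : R, 0 < d & forall e, e <= d -> set_nbhd U e `<=` U.
Proof.
move=> [d d0 Ud]; exists d => // e ed x /set_nbhdP[y Uy xy].
by apply: Ud Uy; rewrite metric_sym; exact: lt_le_trans ed.
Qed.

Lemma continuous_if (T : topologicalType) U (f g : K -> T) :
  unif_clopen U -> continuous f -> continuous g ->
  continuous (fun x => if `[< U x >] then f x else g x).
Proof.
move=> [d d0 Ud] cf cg x A /=.
have Ux : \forall y \near x, U y <-> U x.
  apply/nbhs_ballP; exists d => // y; rewrite ballEmdist/= => xy.
  by split; apply: Ud; rewrite // metric_sym.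
case: asboolP => Uxx Afx.
- apply: filterS2 Ux (cf x _ Afx) => y Uy /= Afy.
  by case: asboolP => // /Uy.
- apply: filterS2 Ux (cg x _ Afx) => y Uy /= Afy.
  by case: asboolP => // /Uy.
Qed.

End unif_clopen.

Lemma continuous_iter (T : topologicalType) (f : T -> T) n :
  continuous f -> continuous (iter n f).
Proof.
by move=> cf; elim: n => [|n IH] x; [exact: cvg_id|];
  apply: (continuous_comp (IH x)); exact: cf.
Qed.

Lemma unif_clopen_preimage (R : realType) (M : pmetricType R) (f : M -> M)
    (U : set M) :
  compact [set: M] -> continuous f -> unif_clopen U -> unif_clopen (f @^-1` U).
Proof.
move=> cM cf [e e0 Ue]; have [d d0 fd] := compact_unif_cts cM cf e0.
by exists d => // x y /fd /Ue.
Qed.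

Lemma homeo_iterS (T : topologicalType) (h : homeo T) (n : int) x :
  homeo_iter h (n + 1) x = h (homeo_iter h n x).
Proof.
case: n => [n|[|n]].
- by rewrite -PoszD addn1.
- by rewrite /= homeo_invK.
- have -> : Negz n.+1 + 1 = Negz n by rewrite !NegzE -addn1 PoszD opprD subrK.
  by rewrite /= homeo_invK.
Qed.

(** * Measures carried by two points *)

Section two_point.
Context {R : realType} {M : pmetricType R}.

Definition two_values (x y : M) : bool -> borel M := fun c => if c then y else x.

HB.instance Definition _ (x y : M) := isMeasurableFun.Build _ _ _ _ (two_values x y)
  (fun _ _ _ => I).

(** The measure (1 - t) delta_x + t delta_y, as the image of a Bernoulli law. *)
Definition two_point (t : R) (x y : M) : pmeasure M :=
  \pi_(pmeasure M) (distribution (bernoulli_prob t : probability bool R)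
    (two_values x y) : probability (borel M) R).

Lemma two_pointE t x y (X : set (borel M)) : 0 <= t <= 1 -> measurable X ->
  repr (two_point t x y) X = (t * \1_X y + (1 - t) * \1_X x)%:E.
Proof.
move=> t01 mX; rewrite pmeasure_piE//= /distribution /pushforward.
by rewrite bernoulli_probE// !diracE !indicE EFinD !EFinM.
Qed.

Lemma induced_two_point (f : M -> M) (cf : continuous f) t x y : 0 <= t <= 1 ->
  induced_map cf (two_point t x y) = two_point t (f x) (f y).
Proof.
move=> t01; apply: pmeasure_ext => X mX; rewrite induced_mapE// !two_pointE//.
exact: measurable_preimage.
Qed.

(** Changing the weight changes the mass of each set by at most [|s - t|]. *)
Lemma prohorov_two_point_le s t d x y : 0 <= s <= 1 -> 0 <= t <= 1 -> 0 < d ->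
  `|s - t| <= d -> mdist (two_point s x y) (two_point t x y) <= d.
Proof.
move=> s01 t01 d0 std; apply: prohorov_le; split => // X mX.
suff H s' t' : 0 <= s' <= 1 -> 0 <= t' <= 1 -> `|s' - t'| <= d ->
    (repr (two_point s' x y) X <=
     repr (two_point t' x y) (set_nbhd X d) + d%:E)%E.
  by split; apply: H => //; rewrite distrC.
move=> s01' t01' std'; apply: (@le_trans _ _ (repr (two_point t' x y) X + d%:E)%E).
  rewrite !two_pointE// -EFinD lee_fin.
  move: std'; rewrite ler_norml => /andP[st1 st2].
  rewrite !indicE.
  by case: (_ \in _); case: (_ \in _) => /=; lra.
apply: leeD => //; apply: le_measure => //; rewrite ?inE//.
  exact: set_nbhd_measurable.
exact: subset_set_nbhd.
Qed.

End two_point.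

(** * An invariant clopen set obstructs weak shadowing *)

Section invariant_set.
Context {R : realType} {M : pmetricType R}.
Variables (cM : compact [set: M]) (h : homeo M) (U : set M).
Hypothesis cU : unif_clopen U.
Hypothesis hU : forall x, U (h x) <-> U x.

Lemma homeo_iter_invariant n x : U (homeo_iter h n x) <-> U x.
Proof.
have hE y : U (h y) = U y by exact/propext.
have hiE y : U (homeo_inv h y) = U y by rewrite -hE homeo_invK.
by case: n => n; elim: n => [|n IH] /=; rewrite 1?hE 1?hiE.
Qed.

Let mU : measurable (U : set (borel M)).
Proof. by apply: sub_sigma_algebra; exact: unif_clopen_open. Qed.

Lemma mass_invariant n mu :
  repr (homeo_iter (induced_homeo cM h) n mu) U = repr mu U.
Proof.
have e1 nu : repr (induced_homeo cM h nu) U = repr nu U.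
  by rewrite induced_mapE//; congr (repr nu _); apply/seteqP; split => x /hU.
have e2 nu : repr (homeo_inv (induced_homeo cM h) nu) U = repr nu U.
  by rewrite -[in RHS](homeo_invK (induced_homeo cM h) nu) e1.
by case: n => n; elim: n => [|n IH] /=; rewrite 1?e1 1?e2.
Qed.

Lemma invariant_not_weak_shadowing a b : U a -> ~ U b ->
  ~ weak_shadowing (induced_homeo cM h).
Proof.
move=> Ua nUb ws; have [r r0 Ur] := unif_clopen_nbhd_sub cU.
(* [r] keeps the [e]-neighbourhood of [U] inside [U]; 1/3 is below half the drop of mass from 1 to
   0. *)
pose e : R := Num.min r (1 / 3).
have e0 : 0 < e by rewrite lt_min r0/=; lra.
have er : e <= r by rewrite ge_min lexx.
have e3 : e <= 1 / 3 by rewrite ge_min lexx orbT.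
have [d d0 {}ws] := ws _ e0.
(* Zero at negative times, then growing by at most [d] per step up to 1. *)
pose t (n : int) : R := if n is Posz k then Num.min 1 (k%:R * d) else 0.
have t01 n : 0 <= t n <= 1.
  case: n => n /=; last by rewrite lexx ler01.
  by rewrite le_min ler01 mulr_ge0 ?ler0n ?(ltW d0)// ge_min lexx.
have td n : `|t n - t (n + 1)| <= d.
  case: n => [n|[|n]].
  - have -> : Posz n + 1 = n.+1 by rewrite -PoszD addn1.
    rewrite /t -[in n.+1%:R]addn1 natrD mulrDl mul1r.
    by rewrite ler_norml /Num.min; case: ifP; case: ifP; lra.
  - by rewrite /= mul0r sub0r normrN /Num.min ltNge ler01/= normr0 ltW.
  - have -> : Negz n.+1 + 1 = Negz n.
      by rewrite !NegzE -addn1 PoszD opprD subrK.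
    by rewrite /= subr0 normr0 ltW.
pose x n := two_point (t n) (homeo_iter h n a) (homeo_iter h n b).
have xE n : repr (x n) U = (1 - t n)%:E.
  rewrite two_pointE//; congr _%:E.
  rewrite !indicE memNset; last by move=> /homeo_iter_invariant.
  rewrite mem_set; last exact/homeo_iter_invariant.
  by rewrite mulr0 add0r mulr1.
have /ws[mu muP] : pseudotrajectory (induced_homeo cM h) d x.
  move=> n; rewrite /= /x induced_two_point// !homeo_iterS.
  exact: prohorov_two_point_le.
(* The orbit point near [x n] gives [U] the same mass as [mu] does, and neighbourhoods of [U] add
   nothing, so the Prohorov bound compares the two masses of [U] directly. *)
have near n : `|fine (repr mu U) - (1 - t n)| <= e.
  have [|_ [m _ <-] /prohorov_ltP[_ /(_ U mU)[]]] :=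
    (set_nbhdP _ _ _).1 (muP (x n) _); first by exists n.
  have sub (nu : pmeasure M) : (repr nu (set_nbhd U e) <= repr nu U)%E.
    apply: le_measure; rewrite ?inE//; last exact: Ur.
    exact: set_nbhd_measurable.
  move=> /le_trans/(_ (leeD2r _ (sub _))) + /le_trans/(_ (leeD2r _ (sub _))).
  rewrite mass_invariant xE -(fineK (fin_num_measure (repr mu) _ mU)).
  by rewrite -!EFinD !lee_fin ler_norml; lra.
have t0 : t 0 = 0 by rewrite /t /= mul0r /Num.min ltNge ler01.
have t1 : t (Num.truncn d^-1).+1 = 1.
  rewrite /t; apply/min_idPl.
  by rewrite -ler_pdivrMr// div1r ltW// truncnS_gt.
have := near (Num.truncn d^-1).+1; have := near 0; rewrite t0 t1.
by rewrite !ler_norml; lra.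
Qed.

End invariant_set.

Lemma unif_clopen_bigcup (R : realType) (K : metricType R) (F : nat -> set K) p :
  (forall j, unif_clopen (F j)) -> unif_clopen (\bigcup_(j in `I_p) F j).
Proof.
move=> cF; elim: p => [|p IH].
  by rewrite II0 bigcup_set0; exact: unif_clopen_set0.
rewrite IIS bigcup_setU bigcup_set1; exact: unif_clopenU.
Qed.

(** * Towers closed up by a swap *)

Section tower.
Context {T : Type} (g phi : T -> T) (C V : set T) (p : nat).
Hypotheses (g_inj : injective g) (phi_inj : injective phi).
Hypotheses (p_gt0 : (0 < p)%N) (VC : V `<=` C).
Hypothesis gC : forall v j, V v -> (0 < j < p)%N -> ~ C (iter j g v).
Hypothesis phiV : forall v, V v -> phi (iter p g v) = v.
Hypothesis phiC : forall z, ~ C z -> phi z = z.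

Definition tower : set T := \bigcup_(j in `I_p) (iter j g @` V).

(** All levels above the base avoid [C]; hence a point of [C] outside [V] witnesses that the tower
    is proper. *)
Lemma tower_meet z : C z -> tower z -> V z.
Proof.
move=> Cz [[|j] /= jp [v Vv vz]]; first by rewrite -vz.
by case: (gC (j := j.+1) Vv); rewrite //= vz.
Qed.

(** Below the top, [g] climbs one level and [phi] fixes the result, which lies outside [C]; from the
    top, [phi] brings [g^p v] back to [v]. Injectivity gives the converse. *)
Lemma tower_invariant y : tower (phi (g y)) <-> tower y.
Proof.
split=> [[j /= jp [v Vv]]|[j /= jp [v Vv <-]]].
  case: j jp => [|j] jp /= vy.
    exists p.-1; first by rewrite /= prednK.
    exists v => //; apply: g_inj; rewrite -iterS prednK//.
    by apply: phi_inj; rewrite phiV.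
  exists j; first exact: ltnW.
  exists v => //; apply/g_inj/phi_inj.
  by rewrite -iterS phiC //; apply: gC.
rewrite -iterS; case: (ltngtP j.+1 p) jp => // [jp|->] _.
- by rewrite phiC; [exists j.+1 => //; exists v|exact: gC].
- by rewrite phiV//; exists 0%N => //; exists v.
Qed.

End tower.

(** * Return times and perturbations in the Cantor space *)

Section cantor.
Context {R : realType}.
Local Notation K := (cantor R).

Definition agree N (x y : K) : Prop := forall k, (k <= N)%N -> x k = y k.

Lemma agreeP N (x y : K) : agree N x y <-> mdist x y < N.+1%:R^-1.
Proof.
rewrite ltNge; split=> [xy|xy k kN].
  by apply/negP => /cantor_dist_geP[k /xy ->]; rewrite eqxx.
by apply/eqP; apply: contraNT xy => xyk; apply/cantor_dist_geP; exists k.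
Qed.

Lemma agree_sym N (x y : K) : agree N x y -> agree N y x.
Proof. by move=> xy k /xy. Qed.

Lemma agree_trans N (y x z : K) : agree N x y -> agree N y z -> agree N x z.
Proof. by move=> xy yz k kN; rewrite xy// yz. Qed.

Lemma agreeW N M (x y : K) : (M <= N)%N -> agree N x y -> agree M x y.
Proof. by move=> MN xy k kM; apply: xy; exact: leq_trans MN. Qed.

Lemma unif_clopen_agree N (x : K) : unif_clopen (agree N x).
Proof.
exists N.+1%:R^-1; first by rewrite invr_gt0.
by move=> y z /agreeP yz /agree_trans; apply.
Qed.

(** Pigeonhole: the orbit of [point] meets only finitely many [N]-cylinders. *)
Lemma return_time_exists N (f : K -> K) :
  exists p, exists2 x, (0 < p)%N & agree N x (iter p f x).
Proof.
pose c n : {ffun 'I_N.+1 -> bool} :=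
  [ffun i : 'I_N.+1 => iter n f point (i : nat)].
have [i [j [ij cij]]] : exists i j, (i < j)%N /\ c i = c j.
  pose m := #|{: {ffun 'I_N.+1 -> bool}}|.
  have : ~ injective (fun i : 'I_m.+1 => c i).
    by move=> /leq_card; rewrite card_ord ltnn.
  apply: contra_notP => nij i j cij; apply/val_inj => /=.
  by case: (ltngtP i j) => // lt; case: nij; [exists i, j|exists j, i].
exists (j - i)%N, (iter i f point); first by rewrite subn_gt0.
move=> k kN; rewrite -iterD subnK 1?ltnW//.
by have /ffunP/(_ (Ordinal (kN : (k < N.+1)%N))) := cij; rewrite !ffunE.
Qed.

Section perturbation.
Variables (g : cantor_homeo R) (N : nat).
Local Notation gi := (homeo_inv g).

(** The minimum is taken over all points at once, so that no point whatsoever returns earlier. *)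
Lemma minimal_return_time : exists p, [/\ (0 < p)%N,
  exists x, agree N x (iter p g x) &
  forall x j, (0 < j < p)%N -> ~ agree N x (iter j g x)].
Proof.
pose P p := `[< exists2 x, (0 < p)%N & agree N x (iter p g x) >].
have exP : exists p, P p.
  by have [p xp] := return_time_exists N g; exists p; apply/asboolP.
have [p /asboolP[x p0 xp] pmin] := ex_minnP exP.
exists p; split => //; first by exists x.
move=> y j /andP[j0 jp] yj; have : (p <= j)%N by apply/pmin/asboolP; exists y.
by rewrite leqNgt jp.
Qed.

Lemma iter_homeoK n : cancel (iter n g) (iter n gi).
Proof. by elim: n => // n IH x; rewrite iterSr /= homeo_funK IH. Qed.

Lemma iter_homeoVK n : cancel (iter n gi) (iter n g).
Proof. by elim: n => // n IH x; rewrite iterSr /= homeo_invK IH. Qed.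

Lemma unif_clopen_tower (V : set K) p : unif_clopen V ->
  unif_clopen (tower g V p).
Proof.
move=> cV; apply: unif_clopen_bigcup => j.
have -> : iter j g @` V = iter j gi @^-1` V.
  apply/seteqP; split=> [_ [v Vv <-]|y Vy]/=; first by rewrite iter_homeoK.
  by exists (iter j gi y); rewrite ?iter_homeoVK.
apply: unif_clopen_preimage cV; first exact: cantor_compact.
exact/continuous_iter/homeo_inv_cts.
Qed.

Section swap.
Variables (p : nat) (V : set K).
Hypothesis cV : unif_clopen V.
Local Notation q := (iter p g).
Local Notation qi := (iter p gi).
Hypothesis Vq : forall v, V v -> V (q v) -> q v = v.

(* Exchanges V and q V when they are disjoint, and is the identity when q is   *)
(* the identity on V.                                                          *)
Definition swap_return (y : K) : K :=
  if `[< V y >] then q y else if `[< V (qi y) >] then qi y else y.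

(** By [Vq], a point common to [V] and its image under [q] is fixed by [q], so the branches never
    conflict. *)
Lemma swap_returnK : involutive swap_return.
Proof.
move=> y; rewrite /swap_return; case: (asboolP (V y)) => Vy.
  case: (asboolP (V (q y))) => Vqy; first by rewrite !(Vq Vy Vqy).
  by rewrite iter_homeoK; case: asboolP.
case: (asboolP (V (qi y))) => Vqiy; last by rewrite !asboolF.
by rewrite asboolT// iter_homeoVK.
Qed.

Lemma swap_return_continuous : continuous swap_return.
Proof.
have cq : continuous q by exact/continuous_iter/homeo_cts.
have cqi : continuous qi by exact/continuous_iter/homeo_inv_cts.
apply: continuous_if => //; apply: (@continuous_if _ _ _ (qi @^-1` V)) => //.
  by apply: unif_clopen_preimage => //; exact: cantor_compact.
by move=> x; exact: cvg_id.
Qed.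

Definition swap_homeo : cantor_homeo R :=
  Homeo swap_return_continuous swap_return_continuous swap_returnK swap_returnK.

End swap.

End perturbation.

Definition comp_homeo (f g : cantor_homeo R) : cantor_homeo R :=
  @Homeo _ (f \o g) (homeo_inv g \o homeo_inv f)
    (fun x => continuous_comp (@homeo_cts _ g x) (@homeo_cts _ f (g x)))
    (fun x => continuous_comp (@homeo_inv_cts _ f x)
                              (@homeo_inv_cts _ g (homeo_inv f x)))
    (can_comp (@homeo_funK _ f) (@homeo_funK _ g))
    (can_comp (@homeo_invK _ g) (@homeo_invK _ f)).

Lemma invariant_set_dense (g : cantor_homeo R) (e : R) : 0 < e ->
  exists h : cantor_homeo R, mdist g h < e /\
  exists U : set K, [/\ unif_clopen U, forall x, U (h x) <-> U x,
    exists a, U a & exists b, ~ U b].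
Proof.
move=> e0; have [N Ne] : exists N, N.+1%:R^-1 < e.
  have [n _ /(_ n (leqnn n))/= ?] := near_infty_natSinv_lt (PosNum e0).
  by exists n.
have [p [p0 [x xq] pmin]] := minimal_return_time g N.
pose q := iter p g.
have [V [cV [a Va] VC qVC [Vq [b [bC nVb]]]]] : exists V : set K,
    [/\ unif_clopen V, exists a, V a, V `<=` agree N x,
     forall v, V v -> agree N x (q v) &
     (forall v, V v -> V (q v) -> q v = v) /\ exists b, agree N x b /\ ~ V b].
  have cq M z : unif_clopen (q @^-1` agree M z).
    apply: unif_clopen_preimage (unif_clopen_agree M z).
      exact: cantor_compact.
    exact/continuous_iter/homeo_cts.
  have [[y [xy xqy qy]]|nqy] := pselect (exists y : K,
    [/\ agree N x y, agree N x (q y) & q y <> y]).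
  - have [i yi] : exists i, y i <> q y i.
      apply: contra_notP qy => nyi; apply/funext => i.
      by apply: contra_notP nyi => yi; exists i; exact/nesym.
    have Ni := leq_maxl N i; have iN := leq_maxr N i.
    (* Up to [N] for staying in the cylinder of [x], up to [i] for separating [V] from its image;
       [q y] is then the point left out. *)
    exists (agree (maxn N i) y `&` q @^-1` agree (maxn N i) (q y)); split.
    + by apply: unif_clopenI => //; exact: unif_clopen_agree.
    + by exists y.
    + by move=> v [/(agreeW Ni) yv _]; exact: agree_trans yv.
    + by move=> v [_ /(agreeW Ni)]; exact: agree_trans.
    + split; last by exists (q y); split=> // -[/(_ i iN)].
      by move=> v [_ qyv] [yqv _]; case: yi; rewrite (yqv _ iN) (qyv _ iN).
  (* Here [q] fixes every point returning to the cylinder. The extra coordinate [N.+1] leaves room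
     for a point outside [V], got by flipping it. *)
  - exists (agree N.+1 x `&` q @^-1` agree N x); split.
    + by apply: unif_clopenI => //; exact: unif_clopen_agree.
    + exists x; split => //.
    + by move=> v [/(agreeW (leqnSn N))].
    + by move=> v [].
    + split=> [v [/(agreeW (leqnSn N)) xv xqv] _|].
        by apply: contra_notP nqy => qv; exists v.
      exists (fun k => if k == N.+1 then ~~ x k else x k); split=> [k kN|[/(_ N.+1)]].
        by rewrite ltn_eqF.
      by rewrite leqnn eqxx => /(_ isT); case: (x _).
pose phi := swap_homeo cV Vq.
(* [V] and its image lie in one [N]-cylinder, so [phi] moves no point out of its own; hence
   [phi \o g] is close to [g]. *)
have phiC y : agree N y (phi y).
  rewrite /phi/= /swap_return; case: asboolP => [Vy|_].
    exact: agree_trans (agree_sym (VC _ Vy)) (qVC _ Vy).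
  case: asboolP => // Vqiy; apply: agree_trans (VC _ Vqiy); apply: agree_sym.
  by rewrite -[y](iter_homeoVK g p); exact: qVC.
exists (comp_homeo phi g); split.
  apply: le_lt_trans Ne; apply: cantor_homeo_dist_le => y.
  by apply/ltW/agreeP; exact: phiC.
exists (tower g V p); split.
- exact: unif_clopen_tower.
- move=> y; apply: (@tower_invariant _ g phi (agree N x)) => //.
  + exact: can_inj (@homeo_funK _ g).
  + exact: can_inj (@homeo_funK _ phi).
  + move=> v j Vv jp /(agree_trans (agree_sym (VC _ Vv))); exact: pmin.
  + move=> v Vv; rewrite /phi/= /swap_return.
    have qv Vqv : iter p g v = v := Vq v Vv Vqv.
    case: asboolP => [/qv {}qv|_]; first by rewrite !qv.
    by rewrite iter_homeoK asboolT.
  + move=> z nCz; rewrite /phi/= /swap_return.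
    case: asboolP => [/VC//|_]; case: asboolP => // /qVC.
    by rewrite /q iter_homeoVK.
- by exists a, 0%N => //; exists a.
- exists b => /(@tower_meet _ g (agree N x)) Vb; apply: nVb; apply: Vb => //.
  by move=> v j Vv jp /(agree_trans (agree_sym (VC _ Vv))); exact: pmin.
Qed.

End cantor.

Theorem theorem14 (R : realType) :
  first_category
    [set h : cantor_homeo R |
      weak_shadowing (induced_homeo (cantor_compact R) h)].
Proof.
set A := (X in first_category X).
exists (fun=> A); split; last by rewrite bigcup_const//; exists 0%N.
move=> _; rewrite /nowhere_dense -subset0 => g /nbhs_ballP[e /= e0 geA].
have [h [gh [U [cU hU [a Ua] [b nUb]]]]] := invariant_set_dense g e0.
have : closure A h by apply: geA; rewrite ballEmdist.
(* For [f] within [d] of [h], the points [f x] and [h x] lie on the same side of [U], so [U] is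
   invariant under [f] too. *)
have [d d0 Ud] := cU.
move=> /(_ (ball h d)) []; first exact: nbhsx_ballx.
move=> f [/= wsf]; rewrite ballEmdist/= => hf.
apply: (invariant_not_weak_shadowing cU _ Ua nUb wsf) => x.
have hfx : mdist (h x) (f x) < d.
  exact: le_lt_trans (cantor_homeo_dist_ge h f x) hf.
by rewrite -(hU x); split; apply: Ud; rewrite // metric_sym.
Qed.
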